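(* Let $F:\Sigma^s\times M\to\Sigma^s\times M$ be a step skew product over the Bernoulli shift whose fiber maps are diffeomorphisms of a compact manifold $M$ (possibly with boundary) onto itself. Then a point $x\in X=\Sigma^s\times M$ belongs to the statistical attractor $A_{stat}(F)$ if and only if the projections onto the fiber of all its preimages belong to the projection of $A_{stat}(F)$, i.e. $\pi_M(F^{-n}(x))\in\pi_M(A_{stat}(F))$ for all $n\ge1$. The same statement holds with the Milnor attractor $A_M(F)$ in place of $A_{stat}(F)$.
   Context: $\Sigma^s=\{1,\dots,s\}^{\mathbb Z}$ with distance $d(\omega,\tilde\omega)=2^{-m}$, $m=\min\{|n|:\omega_n\neq\tilde\omega_n\}$, and the $(1/s,\dots,1/s)$-Bernoulli probability measure $\mu_{\Sigma^s}$; $(\sigma\omega)_n=\omega_{n+1}$ is the Bernoulli shift. $M$ is a compact Riemannian manifold, possibly with boundary. A step skew product with fiber $M$ and fiber maps $f_1,\dots,f_s:M\to M$ is the map $F:X\to X$, $X=\Sigma^s\times M$, $F(\omega,p)=(\sigma\omega,f_{\omega_0}(p))$. The metric on $X$ is the sum of the distances in the base and the fiber; $\mu_X$ is the product of $\mu_{\Sigma^s}$ and the Lebesgue (Riemannian volume) measure on $M$. $\pi_M:X\to M$ is the projection to the fiber. The Milnor attractor $A_M(F)$ is the smallest closed subset of $X$ containing $\omega(x)$ for $\mu_X$-a.e. $x$. For $x\in X$ and $U\subset X$, let $Freq(x,U)=\limsup_{N\to\infty}\frac1N\#\{0\le n<N:F^n(x)\in U\}$; the statistical $\omega$-limit set $\omega_{stat}(x)$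 is the set of $z\in X$ such that $Freq(x,U)>0$ for every neighborhood $U$ of $z$. The statistical attractor $A_{stat}(F)$ is the smallest closed subset of $X$ containing $\omega_{stat}(x)$ for $\mu_X$-a.e. $x$. *)

(* Defs.v *)
From HB Require Import structures.
From mathcomp Require Import all_boot all_order all_algebra.
From mathcomp Require Import all_classical all_reals all_analysis.
Set Implicit Arguments.
Unset Strict Implicit.
Unset Printing Implicit Defensive.
Import Order.TTheory GRing.Theory Num.Theory.
Import numFieldTopology.Exports numFieldNormedType.Exports.
Local Open Scope classical_set_scope.
Local Open Scope ring_scope.

(* Bi-infinite sequences over an alphabet of s.+1 >= 1 symbols; the parameter R
   only records in which real numbers the distance takes its values. *)
Definition Sigma (R : realType) (s : nat) := int -> 'I_s.+1.

Section base_distance.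
Context (R : realType) (s : nat).
Implicit Types w : Sigma R s.

HB.instance Definition _ := Choice.on (Sigma R s).
HB.instance Definition _ :=
  isPointed.Build (Sigma R s) (fun=> ord0).

Definition differ_at w1 w2 (m : nat) : bool :=
  `[< exists k : int, `|k|%N = m /\ w1 k <> w2 k >].

Definition Sigma_dist w1 w2 : R :=
  if pselect (exists m, differ_at w1 w2 m) is left h then 2 ^- ex_minn h else 0.

Lemma Sigma_distP w1 w2 (m : nat) :
  (Sigma_dist w1 w2 <= 2 ^- m) <->
  (forall k : int, (`|k| < m)%N -> w1 k = w2 k).
Proof.
rewrite /Sigma_dist; case: pselect => [h|h]; last first.
  split=> [_ k _|_]; last by rewrite invr_ge0 exprn_ge0.
  by apply: contra_notP h => h; exists `|k|%N; apply/asboolP; exists k.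
case: ex_minnP => p /asboolP [k [kp wk]] pmin.
rewrite lef_pV2 ?posrE ?exprn_gt0// ler_eXn2l ?ltr1n//.
split=> [mp j jm|H].
  apply: contrapT => wj.
  have /pmin : differ_at w1 w2 `|j|%N by apply/asboolP; exists j.
  by move=> pj; move: (leq_ltn_trans pj jm); rewrite ltnNge mp.
by rewrite leqNgt; apply/negP => pm; apply: wk; apply: H; rewrite kp.
Qed.

Lemma Sigma_dist_val w1 w2 :
  Sigma_dist w1 w2 = 0 \/ exists m, Sigma_dist w1 w2 = 2 ^- m.
Proof.
by rewrite /Sigma_dist; case: pselect => [h|_]; [right; eexists|left].
Qed.

Let dist_ge0 w1 w2 : 0 <= Sigma_dist w1 w2.
Proof.
by case: (Sigma_dist_val w1 w2) => [->//|[m ->]]; rewrite invr_ge0 exprn_ge0.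
Qed.

Let distxx w : Sigma_dist w w = 0.
Proof.
by rewrite /Sigma_dist; case: pselect => // h; have [m /asboolP[k [_]]] := h.
Qed.

Let dist_positivity w1 w2 : Sigma_dist w1 w2 = 0 -> w1 = w2.
Proof.
move=> w0; apply/funext => k.
have /Sigma_distP : Sigma_dist w1 w2 <= 2 ^- `|k|.+1.
  by rewrite w0 invr_ge0 exprn_ge0.
by apply; rewrite ltnS.
Qed.

Let dist_sym w1 w2 : Sigma_dist w1 w2 = Sigma_dist w2 w1.
Proof.
have le u v : Sigma_dist u v <= Sigma_dist v u.
  case: (Sigma_dist_val v u) => [h|[m h]].
    by rewrite h (dist_positivity h) distxx.
  rewrite h; apply/Sigma_distP => k km; apply/esym; move: k km.
  by apply/Sigma_distP; rewrite h.
by apply/eqP; rewrite eq_le !le.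
Qed.

Let dist_triangle w2 w1 w3 :
  Sigma_dist w1 w3 <= Sigma_dist w1 w2 + Sigma_dist w2 w3.
Proof.
case: (Sigma_dist_val w1 w2) => [h|[m hm]].
  by rewrite h (dist_positivity h) add0r.
case: (Sigma_dist_val w2 w3) => [h|[p hp]].
  by rewrite h (dist_positivity h) addr0.
have [mp|/ltnW pm] := leqP m p.
  apply: (@le_trans _ _ (Sigma_dist w1 w2)); last first.
    by rewrite lerDl dist_ge0.
  rewrite [leRHS]hm; apply/Sigma_distP => k km.
  rewrite ((Sigma_distP w1 w2 m).1 _ k km) ?hm//.
  by rewrite ((Sigma_distP w2 w3 p).1 _ k (leq_trans km mp)) ?hp.
apply: (@le_trans _ _ (Sigma_dist w2 w3)); last by rewrite lerDr dist_ge0.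
rewrite [leRHS]hp; apply/Sigma_distP => k kp.
rewrite ((Sigma_distP w1 w2 m).1 _ k (leq_trans kp pm)) ?hm//.
by rewrite ((Sigma_distP w2 w3 p).1 _ k kp) ?hp.
Qed.

HB.instance Definition _ := isMetric.Build R (Sigma R s)
  distxx dist_positivity dist_sym dist_triangle.

End base_distance.

Definition borel (T : ptopologicalType) := g_sigma_algebraType (@open T).

(* The uniform Bernoulli measure, characterized by its values on cylinders. *)
Definition is_bernoulli (R : realType) (s : nat)
    (P : probability (borel (Sigma R s)) R) :=
  forall (J : seq int) (a : int -> 'I_s.+1), uniq J ->
    P [set w | forall j, j \in J -> w j = a j] = ((s.+1%:R^-1 ^+ size J)%:E).

Section differentiability.
Context {R : realType} {n : nat} {V : normedModType R}.
Implicit Types (U A : set 'rV[R]_n) (f : 'rV[R]_n -> V).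

Fixpoint Ck (k : nat) U f : Prop :=
  if k is k'.+1 then
    (forall x, U x -> differentiable f x) /\ forall v, Ck k' U ('D_v f)
  else forall x, U x -> {for x, continuous f}.

Definition Cinfty U f := forall k, Ck k U f.

(* On a set that need not be open (a relatively open subset of a half-space),
   regularity means local extendability to an open subset of R^n. *)
Definition locally_extends (C : set 'rV[R]_n -> ('rV[R]_n -> V) -> Prop) A f :=
  forall x, A x -> exists U h,
    [/\ open U, U x, C U h & forall y, A y -> U y -> h y = f y].

End differentiability.

(* Tonelli integral over R^n of a nonnegative Borel function, with respect to
   n-dimensional Lebesgue measure. *)
Fixpoint lebesgue_int (R : realType) (n : nat) : ('rV[R]_n -> \bar R) -> \bar R :=
  if n is n'.+1 then fun h =>
    (\int[@lebesgue_measure R]_t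
       @lebesgue_int R n' (fun v => h (row_mx (t%:M : 'rV_1) v)))%E
  else fun h => h 0.

(* In dimension 0 there is no constraint: half_space is the point R^0. *)
Definition half_space (R : realType) (n : nat) : set 'rV[R]_n :=
  [set x | forall i : 'I_n, i = 0%N :> nat -> 0 <= x 0 i].

(* Smooth manifolds of dimension n, possibly with boundary.  The values of
   [chart i] outside [dom i], and of [param i] outside the image of [chart i],
   are irrelevant. *)
Record manifold (R : realType) (n : nat) (M : ptopologicalType) := Manifold {
  chart_index : Type;
  dom : chart_index -> set M;
  chart : chart_index -> M -> 'rV[R]_n;
  param : chart_index -> 'rV[R]_n -> M;
  manifold_hausdorff : hausdorff_space M;
  manifold_second_countable : @second_countable M;
  dom_open : forall i, open (dom i);
  dom_cover : forall p, exists i, dom i p;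
  chart_open : forall i, exists2 W,
    open W & chart i @` dom i = W `&` @half_space R n;
  chartK : forall i p, dom i p -> param i (chart i p) = p;
  chart_continuous : forall i p, dom i p -> {for p, continuous (chart i)};
  param_continuous : forall i,
    {within chart i @` dom i, continuous (param i)};
  transition_smooth : forall i j,
    locally_extends (@Cinfty R n 'rV[R]_n) (chart i @` (dom i `&` dom j))
      (chart j \o param i)
}.

(* [gram i x] is the Gram matrix of the coordinate vectors of chart i at the
   point of coordinates x.  Tangent vectors are rows and 'J h x acts on them
   from the right; at a boundary point the derivative of a transition map is
   that of any extension h of it that is differentiable there. *)
Record riemannian_metric (R : realType) (n : nat) (M : ptopologicalType)
    (A : manifold R n M) := RiemannianMetric {
  gram : chart_index A -> 'rV[R]_n -> 'M[R]_n;
  gram_smooth : forall i,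
    locally_extends (@Cinfty R n 'M[R]_n) (chart i @` dom i) (gram i);
  gram_sym : forall i p, dom i p -> (gram i (chart i p))^T = gram i (chart i p);
  gram_pos : forall i p (v : 'rV[R]_n), dom i p -> v != 0 ->
    0 < (v *m gram i (chart i p) *m v^T) 0 0;
  gram_change : forall i j p (h : 'rV[R]_n -> 'rV[R]_n),
    dom i p -> dom j p ->
    differentiable h (chart i p) ->
    (\forall q \near p, h (chart i q) = chart j q) ->
    gram i (chart i p) = 'J h (chart i p) *m gram j (chart j p) *m
                         ('J h (chart i p))^T
}.

Definition is_riemannian_volume (R : realType) (n : nat) (M : ptopologicalType)
    (A : manifold R n M) (g : riemannian_metric A)
    (vol : {measure set (borel M) -> \bar R}) :=
  forall (i : chart_index A) (B : set (borel M)), measurable B -> B `<=` dom i ->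
    vol B = lebesgue_int (fun x =>
      (\1_(chart i @` B) x * Num.sqrt (\det (gram g i x)))%:E).

Section diffeomorphisms.
Context {R : realType} {n : nat} {M : ptopologicalType}.
Variable A : manifold R n M.

Definition C1_map (f : M -> M) :=
  continuous f /\
  forall i j : chart_index A,
    locally_extends (@Ck R n 'rV[R]_n 1)
      (chart i @` (dom i `&` f @^-1` dom j))
      (chart j \o f \o param i).

(* C^1 diffeomorphisms of M onto itself, hence also smoother ones. *)
Definition diffeomorphism (f : M -> M) :=
  exists finv, [/\ cancel f finv, cancel finv f, C1_map f & C1_map finv].

End diffeomorphisms.

Section skew_product.
Context {R : realType} {s : nat} {M : ptopologicalType}.
Local Notation X := (Sigma R s * M)%type.

Definition bernoulli_shift (w : Sigma R s) : Sigma R s := fun k => w (k + 1).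

Definition skew_product (f : 'I_s.+1 -> M -> M) (x : X) : X :=
  (bernoulli_shift x.1, f (x.1 0) x.2).

Definition omega_limit (F : X -> X) (x : X) : set X :=
  cluster ((fun k => iter k F x) @ \oo).

Definition Freq (F : X -> X) (x : X) (U : set X) : R :=
  limn_sup (fun N => N%:R^-1 *
    (count (fun k => `[< U (iter k F x) >]) (iota 0 N))%:R).

Definition omega_stat (F : X -> X) (x : X) : set X :=
  [set z | forall U, nbhs z U -> 0 < Freq F x U].

(* The product topology on X is that of the sum of the distances.  As X is
   second countable, the intersection [smallest] is itself a closed set that
   contains the limit sets of almost all points. *)
Definition attractor
    (mu : set (borel (Sigma R s) * borel M)%type -> \bar R)
    (limit_set : X -> set X) : set X :=
  smallest [set A : set X | closed A /\ {ae mu, forall x, limit_set x `<=` A}]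
    set0.

Definition milnor_attractor mu (F : X -> X) := attractor mu (omega_limit F).

Definition stat_attractor mu (F : X -> X) := attractor mu (omega_stat F).

End skew_product.

(* Main.v *)
Require Import Defs.
From HB Require Import structures.
From mathcomp Require Import all_boot all_order all_algebra.
From mathcomp Require Import all_classical all_reals all_analysis.
From mathcomp Require Import zify ring.
Set Implicit Arguments.
Unset Strict Implicit.
Unset Printing Implicit Defensive.
Import Order.TTheory GRing.Theory Num.Theory.
Import numFieldTopology.Exports numFieldNormedType.Exports.
Local Open Scope classical_set_scope.
Local Open Scope ring_scope.

(** The claim holds because an attractor does not see the future of the base
    point: above every fiber point [p] in its projection, and for every finite
    word, the attractor has a point with fiber coordinate [p] whose symbols
    [0, 1, 2, ...] begin with that word.  More precisely, this is true of every
    closed set containing the limit sets of almost all points, up to discarding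
    from it the fibers where it fails.

    Granting this, let [x = (w, p)] be such that every backward iterate
    [x_k = (w shifted back by k, p_k)] has [p_k] in the projection of the
    attractor.  Let [C] be closed and contain almost all limit sets; so does
    its preimage under [F ^ k].  Above [p_k] that preimage has a point whose
    symbols [0, ..., 2k - 1] are those of [x_k].  Its image under [F ^ k] lies
    in [C], agrees with [w] on the window [-k, k), and has fiber coordinate
    [p], because the [k] fiber maps applied are those that lead from [p_k] to
    [p].  As [k] grows these images converge to [x], so [x] is in [C].
    Conversely, limit sets are invariant under [F] and its inverse, hence so
    is the attractor.

    Why the future is invisible.  Let [B] be an open set of the fiber.  Whether
    the orbit of [(w, p)] has its fiber coordinate in [B] at time [n] depends
    on [w] at the times [0, ..., n - 1] only, and the next letter is
    independent of that.  So the visits that are followed by a prescribed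
    letter [a] have to be comparable in number with all visits: almost surely
    there is [K] such that, for all [n],
      [#visits <= (2s + 1) * (K + #visits followed by a)]
    for an alphabet with [s + 1] letters ([visits_letter]).  This comes from
    one nonnegative martingale with initial value 1,
      [rho ^ #visits * 2 ^ - #visits followed by a],
    where [rho] is the constant that makes it a martingale: by the maximal
    inequality it is almost surely bounded.  Iterating over the letters of a
    word gives the same kind of bound for words ([visits_word]).

    Both attractors are governed by a notion of essential set of times,
    infinite for the Milnor attractor and of positive upper density for the
    statistical one, and the limit set consists of the points all of whose
    neighbourhoods are visited at an essential set of times.  Both notions
    depend only on the growth of the number of visits up to a linear
    comparison, so that the bound above transfers essential visits to [B] into
    essential visits to [B] followed by the word.  A compactness argument then
    produces limit points in the prescribed fiber and cylinder
    ([limit_set_fiber]). *)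

(** * Essential sets of times *)

Definition visits (E : set nat) (n : nat) : nat :=
  count (fun k => `[< E k >]) (iota 0 n).

Lemma visitsS E n : visits E n.+1 = (visits E n + `[< E n >])%N.
Proof. by rewrite /visits -addn1 iotaD count_cat /= add0n addn0. Qed.

Lemma eq_visits E E' n : (forall k, (k < n)%N -> E k = E' k) ->
  visits E n = visits E' n.
Proof.
move=> EE'; apply: eq_in_count => k; rewrite mem_iota add0n => /EE' ->.
by [].
Qed.

Lemma visits_le E n : (visits E n <= n)%N.
Proof. by rewrite -[leqRHS](size_iota 0) count_size. Qed.

Lemma visits_mono E m n : (m <= n)%N -> (visits E m <= visits E n)%N.
Proof.
move=> /subnK <-; elim: (n - m)%N => // k IH.
by rewrite addSn visitsS (leq_trans IH)// leq_addr.
Qed.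

Lemma visitsU E E' n :
  (visits (E `|` E') n <= visits E n + visits E' n)%N.
Proof.
elim: n => // n IH; rewrite !visitsS.
have : (`[< (E `|` E') n >] <= `[< E n >] + `[< E' n >])%N.
  by case: asboolP => //= -[] h; rewrite (asboolT h) ?addn1.
lia.
Qed.

Lemma visits0 n : visits set0 n = 0%N.
Proof. by elim: n => // n IH; rewrite visitsS IH; case: asboolP. Qed.

Lemma visits_shift E n : visits E n.+1 = (`[< E 0%N >] + visits (E \o S) n)%N.
Proof.
elim: n => [|n IH]; first by rewrite visitsS addnC.
by rewrite visitsS IH visitsS addnA.
Qed.

(** The two ways of being visited essentially, infinitely often and with
    positive upper density, enter the proof through these properties only.  The
    linear comparison of counts includes monotonicity and insensitivity to a
    shift of time; [modeU] makes the inessential sets of times an ideal, which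
    is what compactness arguments require. *)
Record visit_mode (Phi : set nat -> Prop) := VisitMode {
  mode_le : forall E E' C D,
    (forall n, (visits E n <= C + D * visits E' n)%N) -> Phi E -> Phi E';
  modeU : forall E E', Phi (E `|` E') -> Phi E \/ Phi E';
  mode0 : ~ Phi set0
}.

Section visit_mode_theory.
Variables (Phi : set nat -> Prop) (Phi_mode : visit_mode Phi).

Lemma mode_sub E E' : E `<=` E' -> Phi E -> Phi E'.
Proof.
move=> EE'; apply: (mode_le Phi_mode (C := 0%N) (D := 1%N)) => n.
elim: n => // n; rewrite !visitsS.
by case: asboolP => [/EE'|] ?; case: asboolP => //=; lia.
Qed.

Lemma mode_shift E : Phi (E \o S) <-> Phi E.
Proof.
split; apply: (mode_le Phi_mode (C := 1%N) (D := 1%N)) => n.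
  apply: (@leq_trans (visits E n.+1)); first by rewrite visits_shift leq_addl.
  by rewrite visitsS; case: asboolP => /=; lia.
have := visits_mono E (leqnSn n); rewrite visits_shift.
by case: asboolP => /=; lia.
Qed.

End visit_mode_theory.

Definition infinitely_often (E : set nat) :=
  forall N, exists2 n, (N <= n)%N & E n.

Lemma infinitely_oftenP E :
  infinitely_often E <-> forall m, exists n, (m <= visits E n)%N.
Proof.
split=> [io|unb N].
  elim=> [|m [N mN]]; first by exists 0%N.
  have [n Nn En] := io N; exists n.+1; rewrite visitsS (asboolT En).
  by have := visits_mono E Nn; lia.
apply: contrapT => h; have [n] := unb N.+1; apply/negP; rewrite -ltnNge ltnS.
apply: (@leq_trans (visits E N)); last exact: visits_le.
elim: n => // n IH; rewrite visitsS.
case: asboolP => [En|]; last by rewrite addn0.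
have [Nn|nN] := leqP N n; first by case: h; exists n.
by have := visits_mono E nN; rewrite visitsS (asboolT En).
Qed.

Lemma infinitely_often_mode : visit_mode infinitely_often.
Proof.
split=> [E E' C D EE' /infinitely_oftenP io|E E' /infinitely_oftenP io|io].
- apply/infinitely_oftenP => m; have [n] := io (C + D * m).+1; exists n.
  by have := EE' n; nia.
- apply: contrapT => /not_orP[/infinitely_oftenP/existsNP[m /forallNP mE]
    /infinitely_oftenP/existsNP[m' /forallNP mE']].
  have [n] := io (m + m')%N; have := visitsU E E' n.
  by have /negP := mE n; have /negP := mE' n; lia.
- by have [n] := io 0%N.
Qed.

Section upper_density.
Variable R : realType.

Definition upper_density (E : set nat) : R :=
  limn_sup (fun N => N%:R^-1 * (visits E N)%:R).

(** A description by integers, which removes the upper limit from all later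
    arguments. *)
Lemma upper_density_gt0P E : 0 < upper_density E <->
  exists k, forall N, exists2 n, (N <= n)%N & (n <= k * visits E n)%N.
Proof.
rewrite /upper_density; set u := fun N => _.
have u0 n : 0 <= u n by rewrite mulr_ge0// invr_ge0.
have u1 n : u n <= 1.
  rewrite /u; case: n => [|n]; first by rewrite mulr0.
  by rewrite mulrC ler_pdivrMr// mul1r ler_nat visits_le.
have bu : bounded_fun u.
  exists 1; split=> // y y1 n _ /=; rewrite ger0_norm//.
  exact: le_trans (u1 n) (ltW y1).
have ubu : has_ubound (range u) by exists 1 => _ [n _ <-].
have supsu N : has_sup (sdrop u N).
  split; first by exists (u N); exists N => /=.
  exact: has_ubound_sdrop.
rewrite limn_supE//; split=> [inf0|[k kE]].
  set L := inf _ in inf0.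
  exists (Num.truncn L^-1).+1 => N.
  have Lsup : L <= sups u N.
    by apply: ge_inf; [exact: bounded_fun_has_lbound_sups|exists N].
  have kL : ((Num.truncn L^-1).+1%:R)^-1 < L.
    by rewrite invf_plt ?posrE// ?truncnS_gt// invr_ge0 ltW.
  have [_ [n /= Nn <-] kn] := sup_gt (supsu N).1 (lt_le_trans kL Lsup).
  exists n => //; case: n kn Nn => [|n] kn Nn //.
  move: kn; rewrite /u ltr_pdivlMl// ltr_pdivrMr// mulrC -natrM ltr_nat.
  exact: ltnW.
have k0 : (0 < k)%N.
  by have [[|n] // _] := kE 1%N; case: k kE.
apply: (@lt_le_trans _ _ k%:R^-1); first by rewrite invr_gt0 ltr0n.
apply: lb_le_inf; first by exists (sups u 0%N); exists 0%N.
move=> _ [N _ <-]; have [[|n] //] := kE N.+1 => Nn nk.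
apply: (@le_trans _ _ (u n.+1)); last first.
  by apply: ub_le_sup; [exact: (supsu N).2|exists n.+1 => //=; exact: ltnW].
by rewrite /u ler_pdivlMl// ler_pdivrMr ?ltr0n// -natrM ler_nat mulnC.
Qed.

Lemma upper_density_mode : visit_mode (fun E => 0 < upper_density E).
Proof.
split=> [E E' C D EE' /upper_density_gt0P[k kE]|E E' /upper_density_gt0P[k kE]|].
- apply/upper_density_gt0P; exists (2 * k * D)%N => N.
  (* for n >= 2kC the additive constant absorbs at most half of n *)
  have [n nN nk] := kE (N + 2 * k * C)%N; exists n; first by lia.
  by have := EE' n; nia.
- apply: contrapT => /not_orP[/upper_density_gt0P/forallNP/(_ (2 * k)%N)
    /existsNP[N NE] /upper_density_gt0P/forallNP/(_ (2 * k)%N)/existsNP[N' NE']].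
  have [n nN nk] := kE (N + N')%N; have := visitsU E E' n.
  have : ~ (n <= 2 * k * visits E n)%N.
    by move=> ?; apply: NE; exists n => //; lia.
  have : ~ (n <= 2 * k * visits E' n)%N.
    by move=> ?; apply: NE'; exists n => //; lia.
  by nia.
- move=> /upper_density_gt0P[k /(_ 1%N)[n n1]].
  by rewrite visits0; lia.
Qed.

End upper_density.

(** * Topology of the sequence space *)

Section symbolic_space.
Variables (R : realType) (s : nat).
Local Notation Sg := (Sigma R s).
Implicit Types (w : Sg) (U : set Sg).

Definition window w (m : nat) : set Sg :=
  [set w' | forall k : int, (`|k| < m)%N -> w k = w' k].

Lemma windowS w m w' : window w m w' -> w m%:Z = w' m%:Z ->
  w (- m%:Z) = w' (- m%:Z) -> window w m.+1 w'.
Proof.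
move=> wm wp wn k; rewrite ltnS leq_eqVlt => /orP[/eqP km|]; last exact: wm.
by have [->//|->//] : k = m%:Z \/ k = - m%:Z by lia.
Qed.

Lemma nbhs_window w U : nbhs w U <-> exists m, window w m `<=` U.
Proof.
split=> [/nbhs_ballP[_/posnumP[e] eU]|[m mU]].
  have [m _ /(_ m (leqnn m)) me] := near_infty_natSinv_expn_lt e.
  exists m => w' /Sigma_distP ww'; apply: eU; rewrite ballEmdist /=.
  by apply: le_lt_trans me; rewrite div1r.
apply/nbhs_ballP; exists (2 ^- m) => /=; first by rewrite invr_gt0 exprn_gt0.
by move=> w'; rewrite ballEmdist => /ltW /Sigma_distP/mU.
Qed.

Lemma nbhs_coord w (k : int) : nbhs w [set w' : Sg | w k = w' k].
Proof. by apply/nbhs_window; exists `|k|.+1 => w'; apply. Qed.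

Lemma open_of_window (U : set Sg) m :
  (forall w w', window w m w' -> U w -> U w') -> open U.
Proof.
move=> mU; rewrite openE => w Uw.
by apply/nbhs_window; exists m => w' /mU; apply.
Qed.

(** An ultrafilter decides every letter, the alphabet being finite, and
    converges to the sequence of the letters that it selects. *)
Lemma Sigma_compact : compact [set: Sg].
Proof.
rewrite compact_ultra => F FU _; have FF : ProperFilter F := ultra_proper.
have letter (k : int) : exists b, F [set w : Sg | b = w k].
  apply: contrapT => /forallNP nF.
  have : \forall w \near F, forall b, b <> (w : Sg) k.
    apply: filter_forall => b.
    by have [/nF|] := in_ultra_setVsetC [set w : Sg | b = w k] FU.
  by move=> /filter_ex[w /(_ (w k))].
have [c Fc] := choice letter.
exists c; split=> // U /nbhs_window[m mU]; apply: (filterS mU).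
elim: m {mU} => [|m IH]; first by apply: filterE => w k.
apply: (filterS _ (filterI IH (filterI (Fc m%:Z) (Fc (- m%:Z))))).
by move=> w [wm [? ?]]; exact: windowS.
Qed.

Lemma shift_continuous (d : int) :
  continuous (fun w : Sg => (fun k => w (k + d)) : Sg).
Proof.
move=> w U /nbhs_window[m mU]; apply/nbhs_window; exists (m + `|d|)%N => w' ww'.
by apply: mU => k km; apply: ww'; lia.
Qed.

Lemma letterwise_continuous (T : topologicalType) (h : 'I_s.+1 -> T -> T) k :
  (forall b, continuous (h b)) ->
  continuous (fun x : Sg * T => h (x.1 k) x.2).
Proof.
move=> hc [w p] U /= /(hc _ _) hU.
exists ([set w' | w k = w' k], h (w k) @^-1` U).
  by split=> //; exact: nbhs_coord.
by move=> [w' q] /= [<-].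
Qed.

End symbolic_space.

(** * Supermartingales on the Bernoulli space *)

Section bernoulli.
Variables (R : realType) (s : nat).
Local Notation Sg := (Sigma R s).
Variable P : probability (borel Sg) R.
Hypothesis P_bernoulli : is_bernoulli P.
Local Notation c := ((s.+1%:R^-1) : R).

Definition cylinder (w : Sg) (n : nat) : set Sg :=
  [set w' | forall j : nat, (j < n)%N -> w j%:Z = w' j%:Z].

(** [Y] is measurable with respect to the letters at times [0, ..., n - 1].
    Adapted processes are families [Y n] that depend below [n]; all the events
    about them are then open, hence Borel. *)
Definition depends_below T (n : nat) (Y : Sg -> T) :=
  forall w w', cylinder w n w' -> Y w = Y w'.

Lemma cylinderS m n w w' : (m <= n)%N -> cylinder w n w' -> cylinder w m w'.
Proof. by move=> mn ww' j jm; apply: ww'; exact: leq_trans mn. Qed.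

Lemma measurable_depends n (U : set Sg) :
  depends_below n U -> measurable (U : set (borel Sg)).
Proof.
move=> Un; apply: sub_sigma_algebra; apply: (@open_of_window _ _ _ n).
move=> w w' ww'; rewrite (Un w w')// => j jn; exact: ww'.
Qed.

Lemma measurable_cylinder w n : measurable (cylinder w n : set (borel Sg)).
Proof.
apply: (@measurable_depends n) => w1 w2 w12; apply/propext; split=> h j jn.
  by rewrite h// w12.
by rewrite h// w12.
Qed.

Lemma bernoulli_cylinder w n : P (cylinder w n) = (c ^+ n)%:E.
Proof.
have u : uniq (map Posz (iota 0 n)).
  by rewrite map_inj_uniq ?iota_uniq// => ? ? [].
have := P_bernoulli w u; rewrite size_map size_iota => <-; congr (P _).
apply/seteqP; split=> w' /= h.
  by move=> _ /mapP[j + ->]; rewrite mem_iota add0n => /h.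
by move=> j jn; rewrite h// map_f// mem_iota add0n.
Qed.

Definition update (w : Sg) (n : nat) (b : 'I_s.+1) : Sg :=
  fun k => if k == n%:Z then b else w k.

(** A nonnegative adapted process whose mean over the next letter is at most
    its current value is a supermartingale for the Bernoulli measure, and obeys
    Doob's maximal inequality. *)
Section maximal_inequality.
Variables (Z : nat -> Sg -> R) (t : R).
Hypothesis Z_ge0 : forall n w, 0 <= Z n w.
Hypothesis Z_adapted : forall n, depends_below n (Z n).
Hypothesis Z_super : forall n w,
  \sum_(b < s.+1) Z n.+1 (update w n b) <= s.+1%:R * Z n w.
Hypothesis t_gt0 : 0 < t.

Let exceed n m : set Sg := [set w | exists2 i, (n <= i <= m)%N & t <= Z i w].

Let measurable_exceed n m : measurable (exceed n m : set (borel Sg)).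
Proof.
apply: (@measurable_depends m) => w w' ww'; apply/propext.
split=> -[i /[dup] im /andP[_ /cylinderS ci] tZ]; exists i => //.
  by rewrite -(Z_adapted (ci _ _ ww')).
by rewrite (Z_adapted (ci _ _ ww')).
Qed.

(** Conditioning on a cylinder lets the inequality be proved by induction on
    the remaining number of steps, without integrals: either [Z] exceeds [t]
    now, or one splits the cylinder according to the next letter. *)
Lemma maximal_inequality_from m n w :
  (P (cylinder w n `&` exceed n (n + m)%N) <= (c ^+ n * (Z n w / t))%:E)%E.
Proof.
have mI k n' w' : measurable (cylinder w' n' `&` exceed n' k : set (borel Sg)).
  by apply: measurableI; [exact: measurable_cylinder|exact: measurable_exceed].
have c_ge0 k : 0 <= c ^+ k by rewrite exprn_ge0// invr_ge0.
elim: m n w => [|m IH] n w; have [tZ|Zt] := leP t (Z n w).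
(* t <= Z n w: the bound exceeds the measure of the cylinder *)
1,3: apply: (@le_trans _ _ (P (cylinder w n)));
  [by apply: le_measure; rewrite ?inE; [exact: mI|exact: measurable_cylinder|]
  |by rewrite bernoulli_cylinder lee_fin ler_peMr// ler_pdivlMr// mul1r].
(* Z n w < t and no time is left *)
- have -> : cylinder w n `&` exceed n (n + 0)%N = set0; last first.
    by rewrite measure0 lee_fin !mulr_ge0// invr_ge0 ltW.
  apply/seteqP; split=> // w' [ww' [i]]; rewrite addn0 -eqn_leq => /eqP <-.
  by rewrite -(Z_adapted ww') leNgt Zt.
(* Z n w < t: the level is reached after the next letter b *)
- pose C b := cylinder (update w n b) n.+1 `&` exceed n.+1 (n.+1 + m)%N.
  apply: (@le_trans _ _ (P (\big[setU/set0]_(i < s.+1) C (inord i)))).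
    apply: le_measure; rewrite ?inE; first exact: mI.
      by apply: bigsetU_measurable => i _; exact: mI.
    move=> w' [ww' [i /andP[]]]; rewrite leq_eqVlt => /orP[/eqP <- _|ni im tZ].
      by rewrite -(Z_adapted ww') leNgt Zt.
    rewrite -(bigcup_mkord s.+1 (fun i => C (inord i))).
    exists (w' n%:Z) => /=; first exact: ltn_ord.
    rewrite inord_val; split; last by exists i => //; rewrite ni addSnnS.
    move=> j; rewrite ltnS leq_eqVlt /update => /orP[/eqP ->|jn].
      by rewrite eqxx.
    by rewrite eqz_nat ltn_eqF// ww'.
  apply: (le_trans (Boole_inequality P (A := fun i => C (inord i)) _)).
    by move=> i _; exact: mI.
  apply: (@le_trans _ _ (\sum_(i < s.+1)
    (c ^+ n.+1 * (Z n.+1 (update w n i) / t))%:E)%E).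
    by apply: lee_sum => i _; rewrite inord_val IH.
  rewrite sumEFin lee_fin -mulr_sumr -mulr_suml exprSr -mulrA ler_wpM2l//.
  rewrite mulrA; apply: ler_wpM2r; first by rewrite invr_ge0 ltW.
  by rewrite ler_pdivrMl.
Qed.

Lemma maximal_inequality w0 :
  (P [set w | exists n, (t <= Z n w)%R] <= (Z 0%N w0 / t)%:E)%E.
Proof.
have -> : [set w | exists n, t <= Z n w] = \bigcup_m exceed 0 m.
  apply/seteqP; split=> w /= [n].
    by move=> tZ; exists n => //; exists n; rewrite ?leqnn.
  by move=> _ [i _ tZ]; exists i.
have nd : nondecreasing_seq (exceed 0).
  move=> m m' mm'; apply/subsetPset => w [i /andP[_ im] tZ].
  by exists i => //=; exact: leq_trans mm'.
have := nondecreasing_cvg_mu (mu := P) (measurable_exceed 0) _ nd.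
move=> /(_ (bigcupT_measurable _ (measurable_exceed 0))) Pcvg.
rewrite -(cvg_lim _ Pcvg)//; apply: lime_le.
  by apply/cvg_ex; eexists; exact: Pcvg.
apply: nearW => m /=; have := maximal_inequality_from m 0 w0.
rewrite expr0 mul1r add0n; apply: le_trans; apply: le_measure; rewrite ?inE//.
by apply: measurableI => //; exact: measurable_cylinder.
Qed.

End maximal_inequality.

Lemma negligible_unbounded (Z : nat -> Sg -> R) :
  (forall n w, 0 <= Z n w) -> (forall n, depends_below n (Z n)) ->
  (forall n w, \sum_(b < s.+1) Z n.+1 (update w n b) <= s.+1%:R * Z n w) ->
  P.-negligible [set w | forall K, exists n, 2 ^+ K <= Z n w].
Proof.
move=> Z_ge0 Z_adapted Z_super.
pose B K := [set w | exists n, 2 ^+ K <= Z n w].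
have mB K : measurable (B K : set (borel Sg)).
  rewrite (_ : B K = \bigcup_n [set w | 2 ^+ K <= Z n w]); last first.
    by apply/seteqP; split=> w /= [n]; exists n.
  apply: bigcupT_measurable => n; apply: (@measurable_depends n) => w w' ww'.
  by rewrite /= (Z_adapted _ _ _ ww').
exists (\bigcap_K B K); split; first exact: (bigcapT_measurable mB).
  have PB K : (P (\bigcap_K B K) <= (Z 0%N point / 2 ^+ K)%:E)%E.
    have t_gt0 : 0 < 2 ^+ K :> R by rewrite exprn_gt0.
    apply: (le_trans _ (maximal_inequality Z_ge0 Z_adapted Z_super t_gt0 point)).
    apply: le_measure; rewrite ?inE; first exact: (bigcapT_measurable mB).
      exact: mB.
    by move=> w /(_ K I).
  apply/eqP; rewrite eq_le measure_ge0 andbT leNgt; apply/negP => PA.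
  have Pfin : P (\bigcap_K B K) \is a fin_num.
    by apply: fin_num_measure; exact: (bigcapT_measurable mB).
  have e_gt0 : 0 < fine (P (\bigcap_K B K)) / (Z 0%N point + 1).
    by rewrite divr_gt0 ?fine_gt0 ?PA ?ltey_eq ?Pfin// ltr_wpDl.
  have [K _ /(_ K (leqnn K))] := near_infty_natSinv_expn_lt (PosNum e_gt0).
  rewrite /= ltr_pdivlMr ?ltr_wpDl// ltNge => /negP; apply.
  apply: (@le_trans _ _ (Z 0%N point / 2 ^+ K)).
    by rewrite -lee_fin fineK.
  by rewrite div1r mulrC ler_wpM2l ?invr_ge0 ?exprn_ge0// lerDl.
by move=> w h K _; exact: h.
Qed.

(** * Visits followed by a prescribed word *)

Section comparison.
Variables (V : nat -> set Sg) (a : 'I_s.+1).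
Hypothesis V_adapted : forall n, depends_below n (V n).

Let nV (w : Sg) := visits [set n | V n w].
Let nVa (w : Sg) := visits [set n : nat | V n w /\ w n%:Z = a].
(** With m = s + 1 letters, averaging over the next letter at a visit multiplies
   the process Z below by rho * (s + 1 / 2) / m, which rho makes equal to 1. *)
Let rho : R := s.+1.*2%:R / s.*2.+1%:R.
Let Z n w : R := rho ^+ nV w n / 2 ^+ nVa w n.

Let depends_nV n : depends_below n (nV ^~ n).
Proof.
move=> w w' ww'; apply: eq_visits => k kn /=.
by rewrite (V_adapted (cylinderS (ltnW kn) ww')).
Qed.

Let depends_nVa n : depends_below n (nVa ^~ n).
Proof.
move=> w w' ww'; apply: eq_visits => k kn /=.
by rewrite (V_adapted (cylinderS (ltnW kn) ww')) ww'.
Qed.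

Let cylinder_update w n b : cylinder w n (update w n b).
Proof. by move=> j jn; rewrite /update eqz_nat ltn_eqF. Qed.

Let rho_gt0 : 0 < rho. Proof. by rewrite divr_gt0// ltr0n. Qed.

Let Z_super n w : \sum_(b < s.+1) Z n.+1 (update w n b) <= s.+1%:R * Z n w.
Proof.
have nVS b : nV (update w n b) n.+1 = (nV w n + `[< V n w >])%N.
  rewrite /nV visitsS -/(nV _ _) -(depends_nV (@cylinder_update w n b)) /=.
  by rewrite -(V_adapted (@cylinder_update w n b)).
have nVaS b : nVa (update w n b) n.+1 = (nVa w n + (`[< V n w >] && (b == a)))%N.
  rewrite /nVa visitsS -/(nVa _ _) -(depends_nVa (@cylinder_update w n b)) /=.
  rewrite -(V_adapted (@cylinder_update w n b)) /update eqxx; congr (_ + _)%N.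
  rewrite asbool_and; congr (_ && _ : nat).
  by apply/asboolP/eqP.
under eq_bigr do rewrite /Z nVS nVaS.
case: asboolP => /= [_|_]; last first.
  by under eq_bigr do rewrite !addn0; rewrite sumr_const card_ord mulr_natl.
rewrite (bigD1 a)//= eqxx addn1.
under eq_bigr => b ba do rewrite (negbTE ba) addn0.
rewrite sumr_const cardC1 card_ord /= -/(Z n w).
rewrite /Z addn1 !exprS -mulr_natr.
set q := rho ^+ _; set d : R := 2 ^+ nVa w n.
have d_neq0 : d != 0 by rewrite expf_neq0.
have N_neq0 : 2 * s%:R + 1 != 0 :> R.
  by rewrite lt0r_neq0// ltr_wpDl// mulr_ge0.
rewrite /rho (_ : s.+1.*2 = 2 * s + 2)%N; last by lia.
rewrite (_ : s.*2.+1 = 2 * s + 1)%N; last by lia.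
rewrite -[s.+1]addn1 !(natrD, natrM).
rewrite le_eqVlt; apply/orP; left; apply/eqP; clearbody q d; field.
by rewrite N_neq0 ?andbT.
Qed.

Let rho_ge1 : 1 <= rho.
Proof. by rewrite ler_pdivlMr ?ltr0n// mul1r ler_nat doubleS. Qed.

Let rho_double : 2 <= rho ^+ s.*2.+1.
Proof.
(* Bernoulli's inequality for rho = 1 + 1 / (2s + 1) *)
suff bernoulli k : 1 + k%:R / s.*2.+1%:R <= rho ^+ k.
  by apply: le_trans (bernoulli _); rewrite divff// pnatr_eq0.
elim: k => [|k IH]; first by rewrite mul0r addr0 expr0.
have rhoE : rho = 1 + 1 / s.*2.+1%:R.
  by rewrite /rho doubleS -[s.*2.+2]addn1 natrD mulrDl divff// pnatr_eq0.
rewrite exprS; apply: (le_trans _ (ler_wpM2l (ltW rho_gt0) IH)).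
rewrite rhoE -subr_ge0; set x := s.*2.+1%:R^-1.
rewrite (_ : _ - _ = k%:R * (x * x)); first by rewrite !mulr_ge0// invr_ge0.
by rewrite -natr1 -/x; ring.
Qed.

(** The martingale [Z] is almost surely bounded, say by [2 ^ K], which reads
    [rho ^ nV <= 2 ^ (K + nVa)]; as [rho ^ (2s + 1) >= 2], the number [nV] of
    visits is at most [2s + 1] times [K + nVa]. *)
Lemma visits_letter : P.-negligible [set w |
  forall K, exists n, (s.*2.+1 * (K + nVa w n) < nV w n)%N].
Proof.
apply: negligibleS (negligible_unbounded _ _ Z_super) => [w h K|n w|n w w' ww'].
- have [n] := h K; exists n.
  rewrite /= ler_pdivlMr ?exprn_gt0// -exprD.
  apply: (@le_trans _ _ (rho ^+ (s.*2.+1 * (K + nVa w n)))).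
    by rewrite exprM; apply: lerXn2r; rewrite ?nnegrE ?exprn_ge0 ?(ltW rho_gt0).
  by rewrite ler_weXn2l// ltnW.
- by rewrite divr_ge0 ?exprn_ge0// ltW.
- by rewrite /Z (depends_nV ww') (depends_nVa ww').
Qed.

End comparison.

(** By induction on the length of the word: a visit followed by the first
    letter [a 0], dated at the time just after that letter, is again an adapted
    event, to which the remaining letters apply. *)
Lemma visits_word l (a : nat -> 'I_s.+1) (V : nat -> set Sg) :
  (forall n, depends_below n (V n)) ->
  P.-negligible [set w | forall C, exists n,
    (C + s.*2.+1 ^ l *
       visits [set n | V n w /\ forall i, (i < l)%N -> w (n + i)%N%:Z = a i] n
    < visits [set n | V n w] n)%N].
Proof.
elim: l a V => [|l IH] a V V_adapted.
  exists set0; split=> // w /(_ 0%N)[n].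
  rewrite add0n mul1n (_ : [set _ | _ /\ _] = [set n | V n w]) ?ltnn//.
  by apply/seteqP; split=> k //= [].
pose V' n :=
  if n is n'.+1 then [set w : Sg | V n' w /\ w n'%:Z = a 0%N] else set0.
have V'_adapted n : depends_below n (V' n).
  case: n => //= n w w' ww'.
  by rewrite /V' /= (V_adapted _ _ _ (cylinderS (leqnSn n) ww')) ww'.
have negD := IH (a \o S) V' V'_adapted.
apply: negligibleS (negligibleU (visits_letter (a 0%N) V_adapted) negD) => w bad.
apply: contrapT => /not_orP[/existsNP[K /forallNP hK] /existsNP[C /forallNP hC]].
have [n] := bad (s.*2.+1 * (K + C))%N; apply/negP; rewrite -leqNgt expnS.
have /negP := hK n; rewrite -leqNgt => /leq_trans; apply.
have /negP := hC n.+1; rewrite -leqNgt !visits_shift !(@asboolF (False /\ _))/=.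
- rewrite (@asboolF False)// !add0n.
  have -> : [set n | V' n w] \o S =
    [set n : nat | V n w /\ w n%:Z = a 0%N] by [].
  suff -> : [set m | V' m w /\ forall i, (i < l)%N ->
      w (m + i)%N%:Z = (a \o S) i] \o S =
    [set m | V m w /\ forall i, (i < l.+1)%N -> w (m + i)%N%:Z = a i] by nia.
  apply/seteqP; split=> m /= [].
    move=> [Vm am] am'; split=> // -[|i] il; first by rewrite addn0.
    by rewrite -addSnnS am'.
  move=> Vm am; split; first by split=> //; rewrite -(am 0%N)// addn0.
  by move=> i il; rewrite addSnnS am.
- by case.
Qed.

End bernoulli.

(** * From the Bernoulli measure to the skew product *)

Section joint_measurability.

Lemma measurable_visits d (T : measurableType d) (V : nat -> set T) n k :
  (forall i, measurable (V i)) ->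
  measurable [set x | visits [set i | V i x] n = k].
Proof.
move=> mV; elim: n k => [|n IH] k.
  case: k => [|k].
    by rewrite (_ : [set _ | _] = setT)//; apply/seteqP; split.
  by rewrite (_ : [set _ | _] = set0)//; apply/seteqP; split.
rewrite (_ : [set _ | _] =
  (V n `&` [set x | visits [set i | V i x] n = k.-1 /\ (0 < k)%N]) `|`
  (~` V n `&` [set x | visits [set i | V i x] n = k])); last first.
  apply/seteqP; split=> x /=; rewrite visitsS; case: asboolP => Vx /=.
  - by move=> <-; left; rewrite addn1.
  - by rewrite addn0; right.
  - by move=> [[_ [-> k0]]|[]//]; rewrite addn1 prednK.
  - by move=> [[]//|[_ ->]]; rewrite addn0.
apply: measurableU; apply: measurableI => //; last exact: measurableC.
case: k => [|k].
  by rewrite (_ : [set _ | _] = set0)//; apply/seteqP; split=> x [].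
by rewrite (_ : [set _ | _] = [set x | visits [set i | V i x] n = k])//;
  apply/seteqP; split=> x //= [].
Qed.

Lemma measurable_few_visits d (T : measurableType d) (V V' : nat -> set T) D :
  (forall i, measurable (V i)) -> (forall i, measurable (V' i)) ->
  measurable [set x | forall C, exists n,
    (C + D * visits [set i | V' i x] n < visits [set i | V i x] n)%N].
Proof.
move=> mV mV'.
pose v (W : nat -> set T) n k := [set x | visits [set i | W i x] n = k].
rewrite (_ : [set _ | _] = \bigcap_C \bigcup_n \bigcup_k' \bigcup_k
  (if (C + D * k' < k)%N then v V' n k' `&` v V n k else set0)); last first.
  apply/seteqP; split=> x /= h C.
    have [n hn] := h C; exists n => //.
    exists (visits [set i | V' i x] n) => //.
    by exists (visits [set i | V i x] n) => //; rewrite hn.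
  have [n _ [k' _ [k _]]] := h C I; case: ifP => // Ck [eqk' eqk].
  by exists n; rewrite eqk' eqk.
apply: bigcapT_measurable => C; do 3 apply: bigcupT_measurable => ?.
by case: ifP => // _; apply: measurableI; exact: measurable_visits.
Qed.

Lemma negligible_ysections (R : realType) d1 d2 (T1 : measurableType d1)
    (T2 : measurableType d2) (m1 : {finite_measure set T1 -> \bar R})
    (m2 : {finite_measure set T2 -> \bar R}) (N : set (T1 * T2)) :
  measurable N -> (forall p, m1.-negligible (ysection N p)) ->
  (m1 \x m2)%E.-negligible N.
Proof.
move=> mN N0; exists N; split=> //.
transitivity ((m1 \x^ m2)%E N).
  by apply: product_measure_unique => //= ? ? ? ?; rewrite product_measure2E.
apply: integral0_eq => p _ /=; apply: measure_negligible (N0 p).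
exact: measurable_ysection.
Qed.

Lemma continuous_borel (T U : ptopologicalType) (h : T -> U) : continuous h ->
  measurable_fun [set: borel T] (h : borel T -> borel U).
Proof.
move=> hc.
apply: (@measurability _ _ _ (borel U) _ _ (@open U)) => // _ [V oV <-].
rewrite setTI; apply: sub_sigma_algebra.
by move/continuousP: hc; exact.
Qed.

End joint_measurability.

Section skew_product_orbits.
Variables (R : realType) (s : nat) (M : ptopologicalType).
Variable f : 'I_s.+1 -> M -> M.
Local Notation Sg := (Sigma R s).
Local Notation X := (Sg * M)%type.
Let F : X -> X := skew_product f.

Lemma iter_skew_fst n x k : (iter n F x).1 k = x.1 (k + n%:Z).
Proof.
elim: n k => [|n IH] k; first by rewrite addr0.
by rewrite iterS /F /= /bernoulli_shift IH; congr (x.1 _); lia.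
Qed.

Lemma iter_skew_snd n w w' p : cylinder w n w' ->
  (iter n F (w, p)).2 = (iter n F (w', p)).2.
Proof.
elim: n => // n IH ww'; rewrite !iterS /F /= -/F !iter_skew_fst add0r/= ww'//.
by rewrite IH//; exact: cylinderS ww'.
Qed.

Hypothesis f_continuous : forall b, continuous (f b).

Let T := (borel Sg * borel M)%type.

Lemma measurable_coordinate k b : measurable [set x : T | x.1 k = b].
Proof.
rewrite (_ : [set _ | _] = [set w : Sg | w k = b] `*` setT); last first.
  by apply/seteqP; split=> -[w p] //= [].
apply: measurableX => //; apply: sub_sigma_algebra.
by apply: (@open_of_window _ _ _ `|k|.+1) => w w' /= /(_ k)->.
Qed.

Lemma measurable_skew_product : measurable_fun [set: T] (F : T -> T).
Proof.
apply: measurable_fun_pair.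
  apply: (measurableT_comp
    (f := (@bernoulli_shift R s) : borel Sg -> borel Sg)) => //.
  by apply: continuous_borel; exact: (@shift_continuous R s 1).
apply: (@measurability _ _ _ (borel M) _ _ (@open M)) => // _ [B oB <-].
rewrite setTI (_ : _ @^-1` B = \bigcup_(b : 'I_s.+1)
  ([set x : T | x.1 0 = b] `&` (setT `*` (f b @^-1` B)))); last first.
  apply/seteqP; split=> -[w p] /=.
    by move=> h; exists (w 0).
  by move=> [b _ [/= -> [_]]].
apply: fin_bigcup_measurable => // b _; apply: measurableI.
  exact: measurable_coordinate.
apply: measurableX => //; apply: sub_sigma_algebra.
by have /continuousP := @f_continuous b; apply.
Qed.

Lemma measurable_iter_skew_product n :
  measurable_fun [set: T] (iter n F : T -> T).
Proof.
elim: n => [|n IH]; first exact: measurable_id.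
by apply: (measurableT_comp measurable_skew_product).
Qed.

Variable P : probability (borel Sg) R.
Hypothesis P_bernoulli : is_bernoulli P.
Variable vol : {finite_measure set (borel M) -> \bar R}.
Let mu := (P \x vol)%E.

Definition word (l : nat) (a : nat -> 'I_s.+1) : set Sg :=
  [set w | forall i, (i < l)%N -> w i%:Z = a i].

Lemma depends_word l a : depends_below l (word l a).
Proof.
move=> w w' ww'; apply/propext; split=> h i il; first by rewrite -ww'// h.
by rewrite ww'// h.
Qed.

(** For a fixed initial fiber point the visits to [B] are an adapted family of
    events of the base, so Tonelli's theorem reduces the claim to
    [visits_word]. *)
Lemma visits_word_ae l a (B : set M) : open B ->
  {ae mu, forall x, exists C D, forall n,
    (visits [set n | B (iter n F x).2] n <=
     C + D * visits [set n | word l a (iter n F x).1 /\ B (iter n F x).2] n)%N}.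
Proof.
move=> oB.
pose V n : set T := [set x : T | B (iter n F x).2].
pose V' n : set T := [set x : T | word l a (iter n F x).1 /\ B (iter n F x).2].
have mB : measurable (B : set (borel M)) by exact: sub_sigma_algebra.
have mX (A : set (borel Sg)) n : measurable A ->
    measurable [set x : T | (A `*` B) (iter n F x)].
  move=> mA; rewrite -[X in measurable X]setTI.
  by apply: measurable_iter_skew_product => //; exact: measurableX.
have mV n : measurable (V n).
  rewrite (_ : V n = [set x : T | (setT `*` B) (iter n F x)]); first exact: mX.
  by apply/seteqP; split=> x //= -[].
have mV' n : measurable (V' n).
  by apply: mX; apply: measurable_depends; exact: (@depends_word l a).
have mN := measurable_few_visits (s.*2.+1 ^ l)%N mV mV'.
apply: (negligibleS _ (negligible_ysections (m1 := P) vol mN _)).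
  move=> x /= h C; apply: contrapT => /forallNP hC; apply: h.
  exists C, (s.*2.+1 ^ l)%N => n.
  by rewrite leqNgt; apply/negP; exact: hC.
move=> p; rewrite ysectionE.
have Vp_adapted n : depends_below n [set w : Sg | B (iter n F (w, p)).2].
  by move=> w w' ww' /=; rewrite (iter_skew_snd p ww').
apply: negligibleS (visits_word P_bernoulli l a Vp_adapted) => w /= h C.
have [n hn] := h C; exists n; rewrite (_ : [set _ | _ /\ _] =
  [set i | V' i (w, p)])//.
apply/seteqP; split=> i /= -[h1 h2]; split=> // j jl.
  by rewrite iter_skew_fst/= -h2// addnC.
by have := h1 j jl; rewrite iter_skew_fst/= => <-; rewrite addnC.
Qed.

End skew_product_orbits.

(** * Limit sets and attractors *)

Lemma continuous_pairing (S T U : topologicalType) (g : S -> T) (h : S -> U) :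
  continuous g -> continuous h -> continuous (fun x => (g x, h x)).
Proof. by move=> gc hc x; apply: cvg_pair; [exact: gc|exact: hc]. Qed.

Lemma cancel_iter T (g h : T -> T) k :
  cancel g h -> cancel (iter k g) (iter k h).
Proof.
by move=> gK; elim: k => // k IH x; rewrite iterSr iterS gK.
Qed.

Section limit_sets.
Variables (R : realType) (s : nat) (M : ptopologicalType).
Local Notation Sg := (Sigma R s).
Local Notation X := (Sg * M)%type.

Definition limit_set (Phi : set nat -> Prop) (F : X -> X) (x : X) : set X :=
  [set z | forall U, nbhs z U -> Phi [set n | U (iter n F x)]].

Lemma omega_limitE : @omega_limit R s M = limit_set infinitely_often.
Proof.
apply/funext => F; apply/funext => x; apply/seteqP; split=> z zF.
  move=> U Uz N.
  pose tail := [set iter k F x | k in [set k | (N <= k)%N]].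
  have [|_ [[n Nn <-] Un]] := zF tail U _ Uz.
    by exists N => // k Nk; exists k.
  by exists n.
move=> A B [N _ NA] /zF/(_ N)[n Nn Bn]; exists (iter n F x); split=> //.
exact: NA.
Qed.

Lemma omega_statE :
  @omega_stat R s M = limit_set (fun E => 0 < upper_density R E).
Proof. by []. Qed.

Section dynamics.
Variables (f : 'I_s.+1 -> M -> M) (finv : 'I_s.+1 -> M -> M).
Hypothesis fK : forall b, cancel (f b) (finv b).
Hypothesis finvK : forall b, cancel (finv b) (f b).
Hypothesis f_continuous : forall b, continuous (f b).
Hypothesis finv_continuous : forall b, continuous (finv b).

Let F : X -> X := skew_product f.

Definition skew_inverse (x : X) : X :=
  ((fun k => x.1 (k - 1)) : Sg, finv (x.1 (-1)) x.2).
Let Finv := skew_inverse.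

Lemma skew_productK : cancel F Finv.
Proof.
move=> [w p]; rewrite /F /Finv /skew_product /skew_inverse /bernoulli_shift /=.
by rewrite fK; congr pair; apply/funext => k; rewrite subrK.
Qed.

Lemma skew_inverseK : cancel Finv F.
Proof.
move=> [w p]; rewrite /F /Finv /skew_product /skew_inverse /bernoulli_shift /=.
by rewrite sub0r finvK; congr pair; apply/funext => k; rewrite addrK.
Qed.

Lemma skew_product_continuous : continuous F.
Proof.
apply: continuous_pairing; last exact: letterwise_continuous.
move=> x; apply: (@continuous_comp X Sg Sg fst (@bernoulli_shift R s) x).
  exact: cvg_fst.
exact: (@shift_continuous R s 1).
Qed.

Lemma skew_inverse_continuous : continuous Finv.
Proof.
apply: continuous_pairing; last exact: letterwise_continuous.
move=> x; apply: (@continuous_comp X Sg Sg fst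
  (fun w : Sg => (fun k => w (k - 1)) : Sg) x); first exact: cvg_fst.
exact: (@shift_continuous R s (-1)).
Qed.

Variables (Phi : set nat -> Prop) (Phi_mode : visit_mode Phi).
Let L := limit_set Phi F.

Lemma limit_set_forward x z : L x z -> L x (F z).
Proof.
move=> Lz U /skew_product_continuous /Lz; apply: (mode_shift Phi_mode _).1.
Qed.

Lemma limit_set_backward x z : L x z -> L x (Finv z).
Proof.
move=> Lz U /skew_inverse_continuous /Lz /(mode_shift Phi_mode _).2.
apply: (mode_sub Phi_mode) => n /=; rewrite -/F.
by rewrite /= skew_productK.
Qed.

Hypothesis M_compact : compact [set: M].
Hypothesis M_hausdorff : hausdorff_space M.

Let X_compact : compact [set: X].
Proof. by rewrite -setXTT; apply: compact_setX => //; exact: Sigma_compact. Qed.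

Lemma closed_word l a : closed (word l a : set Sg).
Proof.
rewrite -[word l a]setCK; apply: open_closedC; apply: (@open_of_window _ _ _ l).
by move=> w w' ww' naw aw'; apply: naw => i il; rewrite ww'// aw'.
Qed.

(** If the orbit of [x] essentially visits the word together with every
    neighbourhood of [q], then so it does near some point of the cylinder of the
    word above [q]: a cluster point of the filter of those sets that, above some
    neighbourhood of [q], contain all but inessentially many of the visits to
    the cylinder. *)
Lemma limit_set_fiber x q l a :
  (forall B, nbhs q B ->
    Phi [set n | word l a (iter n F x).1 /\ B (iter n F x).2]) ->
  exists2 z, L x z & word l a z.1 /\ z.2 = q.
Proof.
move=> qPhi.
pose G : set_system X := [set U | exists2 B, nbhs q B & ~ Phi [set n |
  [/\ word l a (iter n F x).1, B (iter n F x).2 & ~ U (iter n F x)]]].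
(* G contains every set that contains the cylinder of the word *)
have small U : (forall y, word l a y.1 -> U y) -> G U.
  move=> aU; exists setT; first exact: filterT.
  move=> /(mode_sub Phi_mode) H; apply: (mode0 Phi_mode); apply: H => n /=.
  by move=> [/aU].
have GF : ProperFilter G.
  split; last split.
  - move=> [B Bq]; apply; apply: (mode_sub Phi_mode) (qPhi B Bq) => n /=.
    by move=> [? ?]; split=> //; case.
  - exact: (small _ (fun _ _ => I)).
  - move=> U U' [B Bq nU] [B' B'q nU']; exists (B `&` B'); first exact: filterI.
    move=> h; have [] : Phi [set n |
        [/\ word l a (iter n F x).1, B (iter n F x).2 & ~ U (iter n F x)]] \/
        Phi [set n |
        [/\ word l a (iter n F x).1, B' (iter n F x).2 & ~ U' (iter n F x)]].
      apply: (modeU Phi_mode).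
      apply: (mode_sub Phi_mode) h => n /= [an [Bn B'n]].
      by move=> /not_andP[]; [left|right].
    + by [].
    + by [].
  - move=> U U' UU' [B Bq nU]; exists B => // /(mode_sub Phi_mode) H.
    by apply: nU; apply: H => n /= [an Bn nU'n]; split=> // /UU'.
have [z [_ zG]] := X_compact GF (small _ (fun _ _ => I)).
exists z.
  move=> U Uz; apply: contrapT => nPhi.
  have [|y []//] := zG (~` U) U _ Uz.
  exists setT; first exact: filterT.
  move=> /(mode_sub Phi_mode) H; apply: nPhi; apply: H => n /= [_ _].
  exact: contrapT.
split.
  apply: contrapT => nz.
  have [||[w p] [/= aw [naw _]]] :=
    zG [set y | word l a y.1] (~` word l a `*` setT).
  - exact: small.
  - exists (~` word l a, setT) => //; split; last exact: filterT.
    apply: open_nbhs_nbhs; split=> //.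
    exact: (closed_openC (@closed_word l a)).
  - exact: naw.
apply: esym; apply: M_hausdorff => B B' Bq B'z.
have [||[w p] [/= Bp [_ B'p]]] := zG [set y | B y.2] (setT `*` B').
- exists B => // /(mode_sub Phi_mode) H; apply: (mode0 Phi_mode); apply: H => n.
  by move=> [].
- by exists (setT, B') => //; split=> //; exact: filterT.
- by exists p.
Qed.

Variable P : probability (borel Sg) R.
Hypothesis P_bernoulli : is_bernoulli P.
Variable vol : {finite_measure set (borel M) -> \bar R}.
Let mu := (P \x vol)%E.

#[local] Instance ae_mu_filter : Filter (nbhs (almost_everywhere (P \x vol)%E)).
Proof. exact: (ae_filter_ringOfSetsType (P \x vol)%E). Qed.

Hypothesis M_second_countable : @second_countable M.

(** One countable basis of the fiber handles all neighbourhoods at once, at the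
    cost of countably many null sets. *)
Lemma limit_set_saturated l a : {ae mu, forall x, forall z, L x z ->
  exists2 z', L x z' & word l a z'.1 /\ z'.2 = z.2}.
Proof.
have [Bs /countable_injP[e e_inj] [Bs_open Bs_basis]] := M_second_countable.
have cmp : \forall x \ae mu, forall k B, Bs B -> e B = k -> exists C D, forall n,
    (visits [set n | B (iter n F x).2] n <=
     C + D * visits [set n | word l a (iter n F x).1 /\ B (iter n F x).2] n)%N.
  apply: (@ae_foralln _ _ _ (P \x vol)%E) => k.
  have [[B [BsB <-]]|nB] := pselect (exists B, Bs B /\ e B = k).
    have oB := Bs_open B BsB.
    have := visits_word_ae f_continuous P_bernoulli vol l a oB.
    apply: filterS => x Bx B' BsB' /e_inj -> //; exact: mem_set.
  by apply: nearW => x B BsB eB; case: nB; exists B.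
apply: filterS cmp => x cmp z Lz; apply: limit_set_fiber => B Bz.
have [B' [BsB' B'z] B'B] := Bs_basis _ _ Bz.
have [C [D CD]] := cmp _ B' BsB' erefl.
apply: (mode_sub Phi_mode (E := [set n | word l a (iter n F x).1 /\
  B' (iter n F x).2])).
  by move=> n /= [? /B'B].
apply: (mode_le Phi_mode CD); apply: (Lz [set y | B' y.2]).
exists (setT, B'); last by move=> [w p] [].
by split; [exact: filterT|apply: open_nbhs_nbhs; split=> //; exact: Bs_open].
Qed.

(** The attractor is the intersection of the sets that carry almost all limit
    sets.  The arguments below are carried out on each of these sets. *)
Definition carries (C : set X) := closed C /\ {ae mu, forall x, L x `<=` C}.

Lemma attractorE x : attractor mu L x <-> forall C, carries C -> C x.
Proof. by split=> [xA C hC|h C [hC _]]; [apply: xA; split|exact: h]. Qed.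

Lemma carries_preimage C : carries C -> carries (F @^-1` C).
Proof.
move=> [clC aeC]; split.
  by have /continuous_closedP := skew_product_continuous; apply.
by apply: filterS aeC => x LC z /limit_set_forward/LC.
Qed.

Lemma carries_image C : carries C -> carries (Finv @^-1` C).
Proof.
move=> [clC aeC]; split.
  by have /continuous_closedP := skew_inverse_continuous; apply.
by apply: filterS aeC => x LC z /limit_set_backward/LC.
Qed.

(** Removing from [C] the fibers that it meets outside the cylinder of the word
    only leaves a closed set, by compactness, and loses no limit set, by
    [limit_set_saturated]. *)
Lemma carries_saturation l a C : carries C ->
  carries (C `&` [set x | exists2 y, C y & word l a y.1 /\ y.2 = x.2]).
Proof.
move=> [clC aeC]; split.
  apply: closedI => //.
  pose K := snd @` (C `&` [set y : X | word l a y.1]).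
  have clK : closed K.
    apply: compact_closed => //; apply: continuous_compact.
      by apply: continuous_subspaceT => y; exact: cvg_snd.
    apply: (subclosed_compact _ X_compact) => //; apply: closedI => //.
    have /continuous_closedP : continuous (@fst Sg M).
      by move=> y; exact: cvg_fst.
    by apply; exact: (@closed_word l a).
  rewrite (_ : [set _ | _] = snd @^-1` K).
    have /continuous_closedP : continuous (@snd Sg M).
      by move=> y; exact: cvg_snd.
    exact.
  apply/seteqP; split=> x /=; first by move=> [y Cy [ay yx]]; exists y.
  by move=> [y [Cy ay] yx]; exists y.
apply: filterS2 aeC (limit_set_saturated l a) => x LC sat z Lz.
by split; [exact: LC|have [z' /LC] := sat z Lz; exists z'].
Qed.

Theorem attractor_criterion x : attractor mu L x <->
  forall k, (1 <= k)%N ->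
    snd @` (iter k F @^-1` [set x]) `<=` snd @` attractor mu L.
Proof.
split=> [/attractorE xA k _ _ [y /= yx <-]|h].
  exists y => //; apply/attractorE => C hC.
  have /xA : carries (iter k Finv @^-1` C).
    by elim: k C hC {yx} => // k IH C /carries_image/IH.
  by rewrite /= -yx cancel_iter//; exact: skew_productK.
apply/attractorE => C hC; have [clC _] := hC.
(* C being closed, it suffices to meet every neighbourhood of x *)
apply: clC => U [[W B] /= [/nbhs_window[m mW] Bx] WBU].
pose k := m.+1; pose y := iter k Finv x.
have yx : iter k F y = x by rewrite cancel_iter//; exact: skew_inverseK.
have [z zA zy] := h k isT y.2 (imageP snd yx).
have hD : carries (iter k F @^-1` C).
  by elim: k C hC {y yx z zA zy} => // k IH C' /carries_preimage/IH.
(* The first k letters of a lead the fiber coordinate of y to that of x; the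
   next k letters are the letters of x at the times 0, ..., k - 1. *)
pose a i := y.1 (Posz i).
have [_ [y' Cy' [ay' y'z]]] :=
  (attractorE z).1 zA _ (carries_saturation k.*2 a hD).
have y'E : y' = (y'.1, y.2) by rewrite -zy -y'z -surjective_pairing.
exists (iter k F y'); split=> //; apply: WBU; split.
  apply: mW => j jm; rewrite -[in LHS]yx !iter_skew_fst.
  have -> : j + k%:Z = `|(j + k%:Z)%R|%N%:Z by lia.
  by rewrite ay'//; lia.
have ay : cylinder y.1 k y'.1.
  by move=> i ik; rewrite ay'// (leq_trans ik)// -addnn leq_addr.
rewrite y'E -(iter_skew_snd f y.2 ay) -surjective_pairing yx.
exact: nbhs_singleton.
Qed.

End dynamics.

End limit_sets.

Unset Implicit Arguments.

Theorem theorem4p7 (R : realType) (s n : nat) (M : ptopologicalType)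
    (A : manifold R n M) (g : riemannian_metric A)
    (f : 'I_s.+1 -> M -> M)
    (P : probability (borel (Sigma R s)) R)
    (vol : {finite_measure set (borel M) -> \bar R}) :
  compact [set: M] ->
  (forall a, diffeomorphism A (f a)) ->
  is_bernoulli P ->
  is_riemannian_volume g vol ->
  let X := (Sigma R s * M)%type in
  let F : X -> X := skew_product f in
  let mu := (P \x vol)%E in
  (forall x : X, stat_attractor mu F x <->
     forall k : nat, (1 <= k)%N ->
       snd @` (iter k F @^-1` [set x]) `<=` snd @` stat_attractor mu F) /\
  (forall x : X, milnor_attractor mu F x <->
     forall k : nat, (1 <= k)%N ->
       snd @` (iter k F @^-1` [set x]) `<=` snd @` milnor_attractor mu F).
Proof.
move=> M_compact /choice[finv f_diffeo] P_bernoulli _ X F mu.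
have fK b : cancel (f b) (finv b) by case: (f_diffeo b).
have finvK b : cancel (finv b) (f b) by case: (f_diffeo b).
have f_cont b : continuous (f b) by have [_ _ []] := f_diffeo b.
have finv_cont b : continuous (finv b) by have [_ _ _ []] := f_diffeo b.
have criterion Phi (Phi_mode : visit_mode Phi) :=
  attractor_criterion fK finvK f_cont finv_cont Phi_mode M_compact
    (manifold_hausdorff A) P_bernoulli vol (manifold_second_countable A).
split.
  rewrite /stat_attractor omega_statE.
  exact: (criterion _ (upper_density_mode R)).
rewrite /milnor_attractor omega_limitE.
exact: (criterion _ infinitely_often_mode).
Qed.
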